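(* Let $S$ be a commutative semigroup with zero $0$, and let $G(S)$ be its zero-divisor graph. Suppose that $G(S)$ is uniquely complemented, that every vertex of $G(S)$ has a unique complement (i.e. for every vertex $a$ there is exactly one vertex $b$ with $a\perp b$), and that the clique number satisfies $\omega(G(S))=n\geq 3$. Then $G(S)$ is isomorphic (as a graph) to $G(\mathcal{P}(X))$, where $X=\{x_1,x_2,\dots,x_n\}$ is a set with $n$ elements. Furthermore, if $S$ has an identity element $1$ and $S=V(G(S))\cup\{0,1\}$, then $S$ is isomorphic as a semigroup to $\mathcal{P}(X)$.
   Context: For a commutative semigroup $S$ with zero $0$, an element $a$ is a zero-divisor if $ab=0$ for some nonzero $b\in S$. The zero-divisor graph $G(S)$ has as vertex set $V(G(S))$ the set of nonzero zero-divisors of $S$, with two distinct vertices $a,b$ adjacent iff $ab=0$. For a graph $G$, $N(a)$ denotes the set of vertices adjacent to $a$. A clique is a set of pairwise adjacent vertices, and the clique number $\omega(G)$ is the maximum number of vertices in a clique. Two distinct vertices $a,b$ are orthogonal, written $a\perp b$, if $a$ and $b$ are adjacent and there is no vertex $c$ adjacent to both $a$ and $b$ (equivalently, the edge $a-b$ lies in no triangle). A graph is complemented if for every vertex $a$ there is a vertex $b$ with $a\perp b$; it is uniquely complemented if it is complemented and whenever $a,b,c$ are distinct vertices with $a\perp b$ and $a\perp c$, then $N(b)=N(c)$. For a set $X$, $\mathcal{P}(X)$ denotes the power set of $X$, a commutative semigroup under intersection with zero $\emptyset$ (and identity $X$); $\mathcal{P}(n)$ denotes $\mathcal{P}(X)$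 for $|X|=n$. Its zero-divisor graph $G(\mathcal{P}(X))$ has as vertices the nonempty proper subsets of $X$, two distinct such subsets being adjacent iff they are disjoint. *)

(* Defs.v *)
From HB Require Import structures.
From mathcomp Require Import all_boot.
From mathcomp Require Import boolp classical_sets functions cardinality.

Set Implicit Arguments.
Unset Strict Implicit.
Unset Printing Implicit Defensive.

Local Open Scope classical_set_scope.
Local Open Scope card_scope.

HB.mixin Record Semigroup_isComSemigroup0 S of Semigroup S := {
  szero : S;
  smulC : commutative (@mul S);
  smul0 : left_zero szero (@mul S)
}.

#[short(type="comSemigroup0Type")]
HB.structure Definition ComSemigroup0 :=
  {S of Semigroup_isComSemigroup0 S & Semigroup S}.

Definition semigroup_isomorphic (S T : semigroupType) :=
  exists f : {multiplicative S -> T}, bijective f.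

(* An alias of {set X}: when X carries a group structure, {set X} already has
   the pointwise product as its canonical multiplication. *)
Definition power_set (X : finType) : Type := {set X}.

HB.instance Definition _ (X : finType) := Choice.on (power_set X).
HB.instance Definition _ (X : finType) :=
  isSemigroup.Build (power_set X) (@finset.setIA X).
HB.instance Definition _ (X : finType) :=
  Semigroup_isComSemigroup0.Build (power_set X) (@finset.setIC X) (@finset.set0I X).

Record graph (T : Type) := Graph {
  vertices : set T;
  adj : T -> T -> Prop;
  adj_vertex : forall a b, adj a b -> vertices a;
  adj_sym : forall a b, adj a b -> adj b a;
  adj_irr : forall a, ~ adj a a
}.

Section GraphTheory.
Variables (T : Type) (G : graph T).

Definition neighbors (a : T) : set T := [set b | adj G a b].

Definition clique (A : set T) :=
  A `<=` vertices G /\ forall a b, A a -> A b -> a <> b -> adj G a b.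

(* The second clause also rules out infinite cliques. *)
Definition clique_number_is (n : nat) :=
  (exists A, clique A /\ A #= `I_n) /\
  (forall A, clique A -> A #<= `I_n).

Definition orthogonal (a b : T) :=
  adj G a b /\ ~ exists c, adj G c a /\ adj G c b.

Definition complemented :=
  forall a, vertices G a -> exists b, orthogonal a b.

Definition uniquely_complemented :=
  complemented /\
  forall a b c, a <> b -> a <> c -> b <> c ->
    orthogonal a b -> orthogonal a c -> neighbors b = neighbors c.

End GraphTheory.

Definition graph_isomorphic (T U : Type) (G : graph T) (H : graph U) :=
  exists f : T -> U, set_bij (vertices G) (vertices H) f /\
    forall a b, vertices G a -> vertices G b ->
      (adj G a b <-> adj H (f a) (f b)).

Section ZeroDivisorGraph.
Variable S : comSemigroup0Type.
Local Notation "0" := (@szero S).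

Definition zero_divisor (a : S) := exists b : S, b <> 0 /\ (a * b)%g = 0.

Definition zdg_vertices : set S := [set a | a <> 0 /\ zero_divisor a].

Definition zdg_adj (a b : S) :=
  [/\ zdg_vertices a, zdg_vertices b, a <> b & (a * b)%g = 0].

Fact zdg_adj_vertex a b : zdg_adj a b -> zdg_vertices a.
Proof. by case. Qed.

Fact zdg_adj_sym a b : zdg_adj a b -> zdg_adj b a.
Proof. by case=> Va Vb ab ab0; split=> //; [exact/nesym | rewrite smulC]. Qed.

Fact zdg_adj_irr a : ~ zdg_adj a a.
Proof. by case. Qed.

Definition zero_divisor_graph : graph S :=
  Graph zdg_adj_vertex zdg_adj_sym zdg_adj_irr.

End ZeroDivisorGraph.

(* Main.v *)
(* Write a' for the unique complement of a vertex a. If a a = 0 with a <> 0,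
   then a S is {0, a} as soon as a has a neighbour other than a', and the products
   of a' with such neighbours and their complements contradict uniqueness; if a'
   is the only neighbour, then a' a' = 0 and the same applies to a'. So S has no
   nonzero nilpotent. Then ann x determines the vertex x, whence x x = x, and
   x y' = 0 forces x y = x. A maximum clique consists of atoms: a proper
   splitting of one of its members would enlarge it. Likewise every vertex lies
   above a member of it, so sending x to the set of atoms p with x p = p
   identifies the vertices with the nonempty proper subsets of the clique. *)

Require Import Defs.
From HB Require Import structures.
From mathcomp Require Import all_boot.
From mathcomp Require Import boolp classical_sets functions cardinality.

Local Open Scope classical_set_scope.

(** Indexing by [nth] is injective on a duplicate-free sequence, which turns [size] into a
    cardinality. *)
Lemma card_eq_uniq {T : eqType} {s : seq T} :
  uniq s -> ([set` s] #= `I_(size s))%card.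
Proof.
case: s => [_|x0 t us]; first by rewrite set_nil II0.
set s := x0 :: t; have -> : [set` s] = nth x0 s @` `I_(size s).
  apply/seteqP; split=> [x /= xs|_ [i /= ilt <-]]; last exact: mem_nth.
  by exists (index x s); [rewrite /mkset index_mem | exact: nth_index].
apply: inj_card_eq => i j /set_mem /= ilt /set_mem /= jlt /eqP.
by rewrite nth_uniq // => /eqP.
Qed.

(** * Orthogonality as equations in the semigroup *)

Section ComplementedSemigroup.
#[local] Set Implicit Arguments.
#[local] Unset Strict Implicit.
Variable S : comSemigroup0Type.
Implicit Types a b c d p q x y z : S.
Local Notation "0" := (@szero S).
Local Notation "x * y" := (@mul S x y).
Local Notation G := (zero_divisor_graph S).

Lemma smul0r x : x * 0 = 0.
Proof. by rewrite smulC smul0. Qed.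

Lemma smulAC x y z : x * y * z = x * z * y.
Proof. by rewrite -!mulgA (smulC y). Qed.

(** Here [c] ranges over all of [S]; the three exceptions are the common annihilators that cannot
    form a triangle with [a] and [b]. *)
Definition orth a b :=
  [/\ a != 0, b != 0, a != b, a * b = 0 &
   forall c, c * a = 0 -> c * b = 0 -> [\/ c = 0, c = a | c = b]].

Lemma zdg_vertexP a z : a != 0 -> z != 0 -> a * z = 0 -> vertices G a.
Proof. by move=> /eqP a0 /eqP z0 az0; split=> //; exists z. Qed.

Lemma vertexE a : vertices G a <-> a != 0 /\ exists2 z, z != 0 & a * z = 0.
Proof.
split=> [[/eqP a0 [z [/eqP z0 az0]]]|[a0 [z z0 az0]]]; last exact: zdg_vertexP az0.
by split=> //; exists z.
Qed.

Lemma orthogonalP a b : orthogonal G a b <-> orth a b.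
Proof.
split.
  move=> [[[/eqP a0 _] [/eqP b0 _] /eqP ab ab0] nt]; split=> // c ca cb.
  have [->|c0] := eqVneq c 0; first by constructor 1.
  have [->|ca'] := eqVneq c a; first by constructor 2.
  have [->|cb'] := eqVneq c b; first by constructor 3.
  case: nt; exists c.
  have [Vc Va Vb]: [/\ vertices G c, vertices G a & vertices G b].
    by split; [exact: zdg_vertexP ca | exact: zdg_vertexP ab0 |
      apply: (@zdg_vertexP b a); rewrite // smulC].
  by split; split=> //; apply/eqP.
move=> [a0 b0 ab ab0 nt]; split.
  split=> //; [exact: zdg_vertexP ab0 | | exact/eqP].
  by apply: (@zdg_vertexP b a) => //; rewrite smulC.
move=> [c [[[c0 _] _ ca ca0] [_ _ cb cb0]]].
by case: (nt c ca0 cb0).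
Qed.

Lemma orth_sym a b : orth a b -> orth b a.
Proof.
move=> [a0 b0 ab ab0 nt]; split; rewrite // 1?eq_sym 1?smulC //.
by move=> c cb ca; case: (nt c ca cb) => ->; [constructor 1|constructor 3|constructor 2].
Qed.

Hypothesis S_unique :
  forall a, vertices G a -> exists! b, orthogonal G a b.

Lemma orth_ex a z : a != 0 -> z != 0 -> a * z = 0 -> exists b, orth a b.
Proof.
move=> a0 z0 az0; have [b [/orthogonalP ab _]] := S_unique (zdg_vertexP a0 z0 az0).
by exists b.
Qed.

Lemma orth_uniq a b c : orth a b -> orth a c -> b = c.
Proof.
move=> ab ac; have [a0 b0 _ ab0 _] := ab.
have [d [_ du]] := S_unique (zdg_vertexP a0 b0 ab0).
by rewrite -(du b) ?(du c) //; apply/orthogonalP.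
Qed.

(* If a s = b, then c a s = 0 puts c in both ann a and ann b. *)
Lemma nil_ideal a b c s : a * a = 0 -> orth a b ->
  c != 0 -> c != a -> c != b -> c * a = 0 -> a * s = 0 \/ a * s = a.
Proof.
move=> aa [a0 b0 ab ab0 nt] c0 ca cb ca0.
have := nt (a * s); rewrite smulAC aa smul0 smulAC ab0 smul0.
case=> // [|-> |asb]; [by left | by right |].
have cb0 : c * b = 0 by rewrite -asb mulgA ca0 smul0.
by case: (nt c ca0 cb0) => /eqP; rewrite ?(negPf c0) ?(negPf ca) ?(negPf cb).
Qed.

(** * Square-zero vertices and their exclusion *)

Section SquareZero.
Variables a b : S.
Hypotheses (aa : a * a = 0) (oab : orth a b).

Let third c := [/\ c != 0, c != a, c != b & c * a = 0].

Let third_ideal c s : third c -> a * s = 0 \/ a * s = a.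
Proof. by case; apply: nil_ideal oab. Qed.

Let third_bc c : third c -> b * c != 0.
Proof.
move=> [c0 ca cb ca0]; apply/eqP => bc0; rewrite smulC in bc0.
have [_ _ _ _ nt] := oab.
by case: (nt c ca0 bc0) => /eqP; rewrite ?(negPf c0) ?(negPf ca) ?(negPf cb).
Qed.

(** If [p a = a] and [p <> b], whatever kills [p] kills [a], so [p] is a complement of [b].
    Uniqueness gives [p = a], hence [p a = a a = 0]. *)
Let ann_complement c p : third c -> p * b = 0 -> p * a = 0.
Proof.
move=> tc pb0; have [a0 b0 ab ab0 nt] := oab.
have [pb|pb] := eqVneq p b; first by rewrite pb smulC.
have [|pa] := third_ideal p tc; first by rewrite smulC.
have p0 : p != 0 by apply: contra_neq a0 => p0; rewrite -pa p0 smul0r.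
suff pa' : orth b p.
  by rewrite -(orth_uniq (orth_sym oab) pa').
split=> //; rewrite 1?eq_sym 1?smulC // => q qb qp.
have qa : q * a = 0 by rewrite -pa mulgA smulAC qp smul0.
have [] := nt q qa qb; [by constructor 1 | move=> qE | by constructor 2].
by case/eqP: a0; rewrite -pa -qE qp.
Qed.

(* Otherwise d = b c' is a vertex outside {a, b}, and d' c' kills b without
   killing a, contrary to ann_complement. *)
Let third_complement c : third c ->
  exists c', [/\ orth c c', a * c' = a & b * c' = a].
Proof.
move=> tc; have [c0 ca cb ca0] := tc; have [a0 b0 ab ab0 nt] := oab.
have [c' oc] := orth_ex c0 a0 ca0; exists c'.
have [_ c'0 cc' cc'0 ntc] := oc.
(* Otherwise [a] kills both [c] and [c'], so [a = c'], and uniqueness gives [c = b]. *)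
have ac' : a * c' = a.
  have [ac'0|//] := third_ideal c' tc.
  have ac0 : a * c = 0 by rewrite smulC.
  have [/eqP|/eqP|ac'] := ntc a ac0 ac'0; rewrite ?(negPf a0) 1?eq_sym ?(negPf ca) //.
  by case/eqP: cb; apply: orth_uniq oab; rewrite ac'; apply: orth_sym.
split=> //; apply/eqP/negPn/negP => da.
set d := b * c' in da.
have d0 : d != 0.
  apply/eqP => d0; case/eqP: a0; rewrite -ac' smulC.
  by apply: ann_complement tc _; rewrite smulC.
have da0 : d * a = 0 by rewrite /d smulAC (smulC b) ab0 smul0.
have dc0 : d * c = 0 by rewrite /d -mulgA (smulC c') cc'0 smul0r.
have db : d != b by apply: contraNneq (third_bc tc) => <-; apply/eqP.
have [d' od] := orth_ex d0 a0 da0; have [_ _ _ dd' ntd] := od.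
have ad' : a * d' = a.
  have [ad'0|//] := third_ideal d' tc.
  have ad0 : a * d = 0 by rewrite smulC.
  have [/eqP|/eqP|ad'] := ntd a ad0 ad'0; rewrite ?(negPf a0) 1?eq_sym ?(negPf da) //.
  by case/eqP: db; apply: orth_uniq oab; rewrite ad'; apply: orth_sym.
case/eqP: a0; rewrite -ad' -{1}ac' -mulgA smulC; apply: ann_complement tc _.
by rewrite smulC mulgA.
Qed.

(** If [c c = 0], then [nil_ideal] for [c], with [a] as extra neighbour, leaves only [c b = c].
    Otherwise [b c] is a complement of [c'], as [c] is. *)
Let third_fixed c : third c -> b * c = c.
Proof.
move=> tc; have [c0 ca cb ca0] := tc; have [a0 b0 ab ab0 nt] := oab.
have [c' [oc ac' bc']] := third_complement tc; have [_ c'0 cc' cc'0 _] := oc.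
have ac : a != c by rewrite eq_sym.
have acn' : a != c' by apply: contra_neq a0 => aE; rewrite -aa {3}aE ac'.
have bc0 := third_bc tc.
have [cc|cc] := eqVneq (c * c) 0.
  have ac0 : a * c = 0 by rewrite smulC.
  by have [/eqP|] := nil_ideal b cc oc a0 ac acn' ac0; rewrite smulC ?(negPf bc0).
suff o : orth c' (b * c) by apply: orth_uniq o (orth_sym oc).
have ea : b * c * a = 0 by rewrite -mulgA ca0 smul0r.
split=> //.
- by apply/eqP => cE; case/eqP: a0; rewrite -ac' smulC cE ea.
- by rewrite smulC -mulgA cc'0 smul0r.
move=> q qc' qe.
have qa : q * a = 0 by rewrite -bc' mulgA smulAC qc' smul0.
have [_ _ _ _ ntc] := oc.
(* Since [q b] kills [c] and [c'], it is [0], [c] or [c']; the last two values would have square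
   zero. *)
have [||qb|qb|qb] := ntc (q * b); first by rewrite -mulgA.
- by rewrite smulAC qc' smul0.
- have [] := nt q qa qb => qE; first by constructor 1.
    by case/eqP: a0; rewrite -ac' -qE.
  by case/eqP: a0; rewrite -bc' -qE.
- by case/eqP: cc; rewrite -{1}qb -mulgA.
have c'c' : c' * c' = 0 by rewrite -{1}qb smulAC qc' smul0.
by case/eqP: a0; rewrite -ac' -ac' -mulgA c'c' smul0r.
Qed.

(** For a third neighbour [c], some further [d] kills [a] and [c], else [c] would be a second
    complement of [a]. Then [d c' = d b c' = d a = 0] forces [d = c'], against [a c' = a]. *)
Lemma nil_degree_le1 c : c != 0 -> c * a = 0 -> c = a \/ c = b.
Proof.
move=> c0 ca0; have [a0 b0 ab ab0 nt] := oab.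
have [->|ca] := eqVneq c a; [by left|].
have [->|cb] := eqVneq c b; [by right|].
have tc : third c by [].
have [c' [[_ _ _ _ ntc] ac' bc']] := third_complement tc.
have bc := third_fixed tc.
have [d dE] : exists d, [/\ d != 0, d != a, d != c, d * a = 0 & d * c = 0].
  apply: contrapT => nd; case/eqP: cb; apply: orth_uniq oab.
  split=> //; rewrite 1?eq_sym 1?smulC // => d da dc.
  have [->|d0] := eqVneq d 0; first by constructor 1.
  have [->|da'] := eqVneq d a; first by constructor 2.
  have [->|dc'] := eqVneq d c; first by constructor 3.
  by case: nd; exists d.
have [d0 da dc da0 dc0] := dE.
have db : d != b by apply: contraNneq (third_bc tc) => <-; apply/eqP.
have td : third d by [].
have dc'0 : d * c' = 0.
  by rewrite -(third_fixed td) smulAC bc' smulC.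
have [/eqP|/eqP|dc'] := ntc d dc0 dc'0; rewrite ?(negPf d0) ?(negPf dc) //.
by case/eqP: a0; rewrite -ac' -dc' smulC.
Qed.

End SquareZero.

(** For [c] outside [a] and its complement [b], the product [a c] kills [a] and [b], so it is [0],
    [a] or [b]. Each value makes [c] or its complement a forbidden neighbour of a square-zero
    vertex. *)
Lemma reduced_of_vertices :
  (forall a b, exists c, [/\ vertices G c, c != a & c != b]) ->
  forall a, a * a = 0 -> a = 0.
Proof.
move=> big a aa; apply/eqP/negPn/negP => a0.
have [b oab] := orth_ex a0 a0 aa; have [_ b0 ab ab0 nt] := oab.
have [c [/vertexE[c0 [z z0 cz]] ca cb]] := big a b.
have ac_b : a * c = b.
  have [||ac|ac|//] := nt (a * c).
  - by rewrite smulAC aa smul0.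
  - by rewrite smulAC ab0 smul0.
  - have [|/eqP|/eqP] := nil_degree_le1 aa oab c0; rewrite ?(negPf ca) ?(negPf cb) //.
    by rewrite smulC.
  have [c' oc] := orth_ex c0 z0 cz; have [_ c'0 _ cc' _] := oc.
  have c'a : c' * a = 0 by rewrite -ac mulgA smulAC (smulC c') cc' smul0.
  have [c'E|c'E] := nil_degree_le1 aa oab c'0 c'a; rewrite c'E in oc.
    by case/eqP: cb; apply: orth_uniq oab; apply: orth_sym.
  by case/eqP: ca; apply: orth_uniq (orth_sym oc) (orth_sym oab).
(* With [a c = b], the element [b] also has square zero, so the degree bound applies to it with [a]
   as its complement. *)
have bb : b * b = 0 by rewrite -{1}ac_b smulAC ab0 smul0.
have [c' oc] := orth_ex c0 z0 cz; have [_ c'0 _ cc' _] := oc.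
have c'b : c' * b = 0 by rewrite -ac_b smulC -mulgA cc' smul0r.
have [c'E|c'E] := nil_degree_le1 bb (orth_sym oab) c'0 c'b; rewrite c'E in oc.
  by case/eqP: ca; apply: orth_uniq (orth_sym oc) (orth_sym oab).
by case/eqP: cb; apply: orth_uniq oab; apply: orth_sym.
Qed.

(** * Orthogonality without nilpotents *)

Section Reduced.
Hypothesis reduced : forall a, a * a = 0 -> a = 0.

(** Without nilpotents, the exceptions [c = a] and [c = b] in [orth] disappear. *)
Lemma orth_ann a b c : orth a b -> c * a = 0 -> c * b = 0 -> c = 0.
Proof.
move=> [a0 b0 ab ab0 nt] ca cb; case: (nt c ca cb) => // cE.
  by apply: reduced; rewrite {2}cE.
by apply: reduced; rewrite {2}cE.
Qed.

Lemma orthI a b : a != 0 -> b != 0 -> a * b = 0 ->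
  (forall c, c * a = 0 -> c * b = 0 -> c = 0) -> orth a b.
Proof.
move=> a0 b0 ab0 nt; split=> //; last by move=> c ca cb; constructor 1; apply: nt.
by apply: contraNneq a0 => ab; apply/eqP/reduced; rewrite {2}ab.
Qed.

(** Let [z] be the complement of [x]. If [c] kills [x y] and [z], then [c x] kills [y] and [y'], so
    [c x = 0] and [c = 0]. Thus [x y] is a complement of [z], as [x] is. *)
Lemma orth_le x y y' : orth y y' -> x * y' = 0 -> x * y = x.
Proof.
move=> oy xy'; have [->|x0] := eqVneq x 0; first by rewrite smul0.
have [_ y'0 _ _ _] := oy.
have [z ox] := orth_ex x0 y'0 xy'; have [_ z0 _ xz _] := ox.
apply: (@orth_uniq z); last exact: orth_sym.
apply/orth_sym/orthI => //.
- by apply: contra_neq x0 => xy; apply: orth_ann oy xy xy'.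
- by rewrite smulAC xz smul0.
move=> c cxy cz; apply: orth_ann ox _ cz; apply: orth_ann oy _ _.
  by rewrite -mulgA.
by rewrite -mulgA xy' smul0r.
Qed.

Lemma vertex_idem x : vertices G x -> x * x = x.
Proof.
move=> /vertexE[x0 [z z0 xz]]; have [x' ox] := orth_ex x0 z0 xz.
by have [_ _ _ xx' _] := ox; apply: orth_le ox xx'.
Qed.

(** Cliques as sequences, so that members can be exchanged and cliques compared by [size]. *)
Definition zclique (s : seq S) :=
  [/\ uniq s, {in s, forall x, vertices G x} &
      {in s &, forall x y, x != y -> x * y = 0}].

Lemma zclique_cons x s : zclique s -> vertices G x ->
  {in s, forall y, x * y = 0} -> zclique (x :: s).
Proof.
move=> [us Vs s0] Vx xs; split=> /=.
- rewrite us andbT; apply/negP => xin.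
  by have /vertexE[/eqP x0 _] := Vx; apply/x0/reduced/xs.
- by move=> y /predU1P[->//|/Vs].
move=> y z /predU1P[->|ys] /predU1P[->|zs]; rewrite ?eqxx // => yz.
- exact: xs.
- by rewrite smulC; apply: xs.
exact: s0.
Qed.

(** * Maximum cliques consist of atoms *)

Section MaximalClique.
Variable s : seq S.
Hypotheses (s_clique : zclique s)
  (s_max : forall t, zclique t -> size t <= size s).

(* Were p to split as x + y with x = z p and y = p x', replacing p by x and y
   would enlarge the clique. *)
Lemma clique_atom p z : p \in s -> z * p = 0 \/ z * p = p.
Proof.
move=> ps; have [us Vs s0] := s_clique.
have [p0 [w w0 pw]] := (vertexE p).1 (Vs p ps).
set x := z * p; have [->|x0] := eqVneq x 0; [by left|].
have pp : p * p = p by apply/vertex_idem/Vs.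
have xp : x * p = x by rewrite /x -mulgA pp.
have xw : x * w = 0 by rewrite /x -mulgA pw smul0r.
have [x' ox] := orth_ex x0 w0 xw; have [_ x'0 _ xx' _] := ox.
(* If [p x' = 0], then [p x = p] by [orth_le], while [x p = x]; so [x = p]. *)
have [y0|y0] := eqVneq (p * x') 0.
  by right; rewrite -(orth_le ox y0) smulC.
have kill q : q \in rem p s -> p * q = 0.
  rewrite (rem_filter p us) mem_filter /= => /andP[qp qs].
  by rewrite s0 // eq_sym.
suff /s_max /= : zclique [:: x, p * x' & rem p s].
  by rewrite /= (size_rem ps) prednK ?ltnn //; case: (s) ps.
apply: zclique_cons; first apply: zclique_cons.
- split; first exact: rem_uniq.
    by move=> q /mem_rem/Vs.
  by move=> q r /mem_rem qs /mem_rem rs; apply: s0.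
- by apply: zdg_vertexP w0 _ => //; rewrite smulAC pw smul0.
- by move=> q /kill pq; rewrite smulAC pq smul0.
- exact: zdg_vertexP xw.
move=> q; rewrite inE => /predU1P[->|/kill pq].
  by rewrite mulgA xp.
by rewrite /x -mulgA pq smul0r.
Qed.

(** Otherwise [x] kills every atom in [s] and could be added to the clique. *)
Lemma clique_below x : vertices G x -> exists2 p, p \in s & x * p = p.
Proof.
move=> Vx; apply: contrapT => nx.
suff /s_max /= : zclique (x :: s) by rewrite ltnn.
apply: zclique_cons => // p ps; have [//|xp] := clique_atom x ps.
by case: nx; exists p.
Qed.

Lemma clique_neq0 p : p \in s -> p != 0.
Proof. by have [_ Vs _] := s_clique => /Vs/vertexE[]. Qed.

Lemma clique_orth x x' p : orth x x' -> p \in s ->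
  x' * p = p <-> x * p = 0.
Proof.
move=> ox ps; have [_ _ _ xx' _] := ox; split=> [x'p|xp].
  by rewrite -x'p mulgA xx' smul0.
have [x'p|//] := clique_atom x' ps.
case/eqP: (clique_neq0 ps).
by apply: orth_ann ox _ _; rewrite smulC.
Qed.

(** If [x y'] were nonzero, it would be a vertex, killed by [y], and so lie above some atom [p].
    This [p] lies below [x], hence below [y], but also below [y']. *)
Lemma clique_below_le x y : vertices G x -> vertices G y ->
  {in s, forall p, x * p = p -> y * p = p} -> x * y = x.
Proof.
move=> Vx /vertexE[y0 [z z0 yz]] xy.
have [y' oy] := orth_ex y0 z0 yz; have [_ _ _ yy' _] := oy.
apply: orth_le oy _; apply/eqP/negPn/negP => xy'.
have Vxy' : vertices G (x * y').
  by apply: zdg_vertexP y0 _ => //; rewrite -mulgA (smulC y') yy' smul0r.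
have [p ps xy'p] := clique_below Vxy'.
have xp : x * p = p.
  have [|//] := clique_atom x ps.
  move=> xp; case/eqP: (clique_neq0 ps).
  by rewrite -xy'p smulAC xp smul0.
case/eqP: (clique_neq0 ps).
by rewrite -(xy p ps xp) -xy'p !mulgA (smulAC y x) yy' !smul0.
Qed.

End MaximalClique.

(** * Coordinates given by the atoms *)

Section Coordinates.
Variables (X : finType) (atom : X -> S).
Hypotheses (atom_clique : zclique (codom atom))
  (atom_max : forall t, zclique t -> size t <= #|X|).

Let atom_max' t : zclique t -> size t <= size (codom atom).
Proof. by rewrite size_codom; apply: atom_max. Qed.

Definition support x : power_set X := [set i | x * atom i == atom i]%SET.

Lemma support0 : support 0 = finset.set0.
Proof.
apply/setP => i; rewrite !inE smul0 eq_sym.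
exact/negbTE/(clique_neq0 atom_clique)/codom_f.
Qed.

Lemma supportM x y : support (x * y) = (support x :&: support y)%SET.
Proof.
apply/setP => i; rewrite !inE; apply/eqP/andP => [xyi|[/eqP xi /eqP yi]]; last first.
  by rewrite -mulgA yi.
have [yi|yi] := clique_atom atom_clique atom_max' y (codom_f atom i).
  have := clique_neq0 atom_clique (codom_f atom i).
  by rewrite -xyi -mulgA yi smul0r eqxx.
by rewrite yi eqxx -{1}yi mulgA xyi.
Qed.

Lemma vertex_atom i : vertices G (atom i).
Proof. by have [_ Vs _] := atom_clique; apply/Vs/codom_f. Qed.

Lemma support_orth x x' : orth x x' -> support x' = (~: support x)%SET.
Proof.
move=> ox; apply/setP => i; rewrite !inE; have ai := codom_f atom i.
have [xi|xi] := clique_atom atom_clique atom_max' x ai.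
  rewrite (clique_orth atom_clique atom_max' ox ai).2 // xi eqxx eq_sym.
  by rewrite (clique_neq0 atom_clique ai).
rewrite xi eqxx; apply/eqP => x'i.
have := (clique_orth atom_clique atom_max' ox ai).1 x'i.
by apply/eqP; rewrite xi (clique_neq0 atom_clique ai).
Qed.

Lemma support_atom i : support (atom i) = [set i]%SET.
Proof.
apply/setP => j; rewrite !inE; have [->|ji] := eqVneq j i.
  exact/eqP/vertex_idem/vertex_atom.
have [us _ s0] := atom_clique.
(* Uniqueness of [codom atom] is by definition injectivity of [atom]. *)
have /injectiveP inj : injectiveb atom by [].
rewrite s0 ?codom_f //; last by rewrite (inj_eq inj) eq_sym.
by rewrite eq_sym; apply/negbTE/(clique_neq0 atom_clique)/codom_f.
Qed.

Lemma support_neq0 x : vertices G x -> support x != finset.set0.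
Proof.
move=> Vx; have [_ /codomP[i ->] xi] := clique_below atom_clique atom_max' Vx.
by apply/set0Pn; exists i; rewrite inE xi.
Qed.

Lemma vertex_orth x : vertices G x -> exists2 x', vertices G x' & orth x x'.
Proof.
move=> /vertexE[x0 [z z0 xz]]; have [x' ox] := orth_ex x0 z0 xz.
exists x' => //; have [_ x'0 _ xx' _] := ox.
by apply: zdg_vertexP x0 _; rewrite // smulC.
Qed.

Lemma support_neqT x : vertices G x -> support x != [set: X]%SET.
Proof.
move=> /vertex_orth[x' Vx' ox]; have := support_neq0 Vx'.
by rewrite (support_orth ox); apply: contraNneq => ->; rewrite finset.setCT.
Qed.

Lemma support_inj x y : vertices G x -> vertices G y ->
  support x = support y -> x = y.
Proof.
move=> Vx Vy xy; have le := clique_below_le atom_clique atom_max'.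
rewrite -(le _ _ Vx Vy) 1?smulC ?(le _ _ Vy Vx) //.
  move=> _ /codomP[i ->] /eqP yi; apply/eqP.
  by have /setP/(_ i) := xy; rewrite !inE yi => ->.
move=> _ /codomP[i ->] /eqP yi; apply/eqP.
by have /setP/(_ i) := xy; rewrite !inE yi => <-.
Qed.

(** The complement of [atom k] has support [~: [set k]]; multiplying these over all [k] outside [B]
    leaves support [B]. *)
Lemma support_surj (B : {set X}) : B != finset.set0 -> B != [set: X]%SET ->
  exists2 x, vertices G x & support x = B.
Proof.
move=> B0 BT.
have co k : exists2 y, y * atom k = 0 & support y = (~: [set k])%SET.
  have [y _ oy] := vertex_orth (vertex_atom k); exists y.
    by have [_ _ _ ky _] := oy; rewrite smulC.
  by rewrite (support_orth oy) support_atom.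
(* The index [i] starts the product, as no identity is available for an empty one, and keeps
   [atom i] as an annihilator. *)
have ex i (t : seq X) : exists2 x, x * atom i = 0 &
    support x = (~: [set j in i :: t])%SET.
  elim: t => [|k t [x xi xt]].
    by have [y yi ys] := co i; exists y; rewrite // ys; apply/setP => j; rewrite !inE.
  have [y _ ys] := co k; exists (x * y); first by rewrite smulAC xi smul0.
  rewrite supportM xt ys; apply/setP => j; rewrite !inE.
  by case: (j == i); case: (j == k); case: (j \in t).
have /set0Pn[i iB] : (~: B)%SET != finset.set0.
  by apply: contraNneq BT => B'; rewrite -(finset.setCK B) B' finset.setC0.
have [x xi xB] := ex i (enum (~: B)%SET).
have xE : support x = B.
  rewrite xB; apply/setP => j; rewrite !inE mem_enum !inE negb_or negbK.
  by have [->|//] := eqVneq j i; move: iB; rewrite inE => /negbTE.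
exists x => //; apply: zdg_vertexP xi.
  by apply: contraNneq B0 => x0; rewrite -xE x0 support0.
exact: (clique_neq0 atom_clique (codom_f atom i)).
Qed.

End Coordinates.

End Reduced.

(** * Passage between set cliques and sequences *)

Lemma zclique_clique s : zclique s -> clique G [set` s].
Proof.
move=> [_ Vs s0]; split=> [x /Vs //|x y xs ys /eqP xy].
by split; [exact: Vs | exact: Vs | exact/eqP | exact: s0].
Qed.

Lemma clique_zclique (A : set S) n : clique G A -> (A #= `I_n)%card ->
  exists2 s, zclique s & size s = n.
Proof.
move=> [AV Aadj] An.
have /finite_seqP[t tA] : finite_set A by apply/finite_setP; exists n.
have At x : x \in undup t -> A x by rewrite mem_undup tA.
exists (undup t).
  split; [exact: undup_uniq | by move=> x /At/AV |].
  by move=> x y /At Ax /At Ay /eqP xy; have [] := Aadj x y Ax Ay xy.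
apply/esym/card_eq_II; apply: card_eq_trans (card_esym An) _; rewrite tA.
have -> : [set` t] = [set` undup t].
  by apply/seteqP; split=> x /=; rewrite mem_undup.
exact/card_eq_uniq/undup_uniq.
Qed.

Lemma clique_enum n (X : finType) :
    clique_number_is G n -> #|X| = n ->
  exists2 atom : X -> S, zclique (codom atom) &
    forall t, zclique t -> size t <= #|X|.
Proof.
move=> [[A [cA An]] max] Xn; have [s cs sn] := clique_zclique cA An.
(* The default [0] is never reached, since [size s] equals the cardinality of [X]. *)
exists (fun i => nth 0 s (enum_rank i)); last first.
  move=> t ct; have [ut _ _] := ct; rewrite Xn -card_le_II.
  by rewrite -(card_le_eql (card_eq_uniq ut)); apply/max/zclique_clique.
suff -> : codom (fun i : X => nth 0 s (enum_rank i)) = s by [].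
apply: (@eq_from_nth _ 0) => [|i]; rewrite size_codom; first by rewrite Xn sn.
by move=> iX; rewrite (nth_codom _ _ (Ordinal iX)) enum_valK.
Qed.

End ComplementedSemigroup.

(** * The power set graph and the two isomorphisms *)

Lemma power_set_vertexE (X : finType) (B : power_set X) :
  vertices (zero_divisor_graph (power_set X)) B <->
  B != finset.set0 /\ B != [set: X]%SET.
Proof.
split=> [/vertexE[B0 [C C0 BC]]|[B0 BT]].
  split=> //; apply: contraNneq C0 => BT.
  by rewrite -BC BT; apply/eqP; rewrite -[RHS]/(finset.setI _ _) finset.setTI.
apply/vertexE; split=> //; exists (~: B : {set X})%SET.
  by apply: contraNneq BT => B'; rewrite -(finset.setCK B) B' finset.setC0.
exact: finset.setICr.
Qed.

Theorem theorem2p2 (S : comSemigroup0Type) (n : nat)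
    (S_uc : uniquely_complemented (zero_divisor_graph S))
    (S_unique : forall a : S, vertices (zero_divisor_graph S) a ->
       exists! b : S, orthogonal (zero_divisor_graph S) a b)
    (omega_n : clique_number_is (zero_divisor_graph S) n)
    (n_ge3 : 3 <= n)
    (X : finType) (X_n : #|X| = n) :
  graph_isomorphic (zero_divisor_graph S) (zero_divisor_graph (power_set X)) /\
  (forall e : S, left_id e (@mul S) -> right_id e (@mul S) ->
     [set: S] = vertices (zero_divisor_graph S) `|` [set szero; e] ->
     semigroup_isomorphic S (power_set X)).
Proof.
have [atom atom_clique atom_max] := clique_enum omega_n X_n.
have reduced : forall a : S, mul a a = szero -> a = szero.
  apply: (reduced_of_vertices S_unique) => a b.
  have [us Vs _] := atom_clique.
  (* At least three distinct atoms cannot all lie among [a] and [b]. *)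
  have [c cs cab] : exists2 c, c \in codom atom & c \notin [:: a; b].
    apply/hasP; rewrite has_predC; apply/negP => /allP sub.
    by have := uniq_leq_size us sub; rewrite size_codom X_n leqNgt n_ge3.
  by move: cab; rewrite !inE negb_or => /andP[ca cb]; exists c; split=> //; apply: Vs.
pose phi := support atom.
have phi0 : phi szero = finset.set0 by apply: support0.
have phiM x y : phi (mul x y) = (phi x :&: phi y)%SET by apply: supportM.
have phi_neq0 x : vertices (zero_divisor_graph S) x -> phi x != finset.set0.
  by apply: support_neq0.
have phi_neqT x : vertices (zero_divisor_graph S) x -> phi x != [set: X]%SET.
  by apply: support_neqT.
have phi_inj x y : vertices (zero_divisor_graph S) x ->
    vertices (zero_divisor_graph S) y -> phi x = phi y -> x = y.
  by apply: support_inj.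
have phi_surj B : B != finset.set0 -> B != [set: X]%SET ->
    exists2 x, vertices (zero_divisor_graph S) x & phi x = B.
  by apply: support_surj.
split.
  have phiV x : vertices (zero_divisor_graph S) x ->
      vertices (zero_divisor_graph (power_set X)) (phi x).
    by move=> Vx; apply: (power_set_vertexE X (phi x)).2 _; rewrite phi_neq0 ?phi_neqT.
  exists phi; split.
    split.
    - exact: phiV.
    - by move=> x y /set_mem Vx /set_mem Vy; apply: phi_inj.
    - by move=> B /(power_set_vertexE X B).1 [B0 BT]; have [x Vx xB] := phi_surj B B0 BT; exists x.
  move=> a b Va Vb; have [a0 [z [z0 az]]] := Va.
  split=> [[_ _ ab ab0]|[_ _ ab ab0]].
    split; [exact: phiV | exact: phiV | |].
      by move=> /(phi_inj _ _ Va Vb).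
    by rewrite -[LHS]phiM ab0 phi0.
  split=> //; first by move=> abE; apply: ab; rewrite abE.
  (* A nonzero [a b] is killed by [z], so it would be a vertex with empty support. *)
  have [//|ab_neq0] := eqVneq (mul a b) szero.
  have /phi_neq0 : vertices (zero_divisor_graph S) (mul a b).
    by split; [exact/eqP | exists z; split=> //; rewrite smulAC az smul0].
  by move=> /eqP[]; rewrite phiM; apply: ab0.
move=> e e1 _ SE.
have phie : phi e = [set: X]%SET by apply/setP => i; rewrite !inE e1 eqxx.
have cover x : [\/ vertices (zero_divisor_graph S) x, x = szero | x = e].
  have : [set: S] x by [].
  by rewrite SE => -[|[]]; [constructor 1|constructor 2|constructor 3].
have X0 : [set: X]%SET != finset.set0.
  by rewrite -card_gt0 cardsT X_n; case: (n) n_ge3.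
(* Vertices have nonempty proper supports, [szero] the empty one and [e] the full one, so the three
   cases cannot collide. *)
have phi_injT : injective phi.
  move=> x y; case: (cover x) => [Vx|->|->]; case: (cover y) => [Vy|->|->] //;
    rewrite ?phi0 ?phie => // xy.
  - exact: phi_inj.
  - by have := phi_neq0 x Vx; rewrite xy eqxx.
  - by have := phi_neqT x Vx; rewrite xy eqxx.
  - by have := phi_neq0 y Vy; rewrite -xy eqxx.
  - by have := X0; rewrite -xy eqxx.
  - by have := phi_neqT y Vy; rewrite -xy eqxx.
  - by have := X0; rewrite xy eqxx.
have phi_surjT B : exists x, phi x = B.
  have [->|B0] := eqVneq B finset.set0; first by exists szero.
  have [->|BT] := eqVneq B [set: X]%SET; first by exists e.
  by have [x _ xB] := phi_surj B B0 BT; exists x.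
have [psi psiK] := choice phi_surjT.
pose phi_mul := isMultiplicative.Build S (power_set X) phi phiM.
exists (HB.pack_for {multiplicative S -> power_set X} phi phi_mul); exists psi => //= x.
by apply: phi_injT; rewrite psiK.
Qed.
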